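(* There exist two finite connected graphs $G$ and $G'$ (without loops or multiple edges) such that $T_G(x,y) = T_{G'}(x,y)$ and $\operatorname{Jac}(G) \cong \operatorname{Jac}(G')$ as abelian groups, but $Z_G(t,u) \neq Z_{G'}(t,u)$.
   Context: All graphs are finite, connected, without loops or multiple edges. $T_G(x,y)$ denotes the Tutte polynomial of $G$. For a graph $G$ with vertices $v_1,\dots,v_n$, a divisor is a formal sum $D=\sum a_i v_i$ with $a_i\in\mathbb{Z}$, of degree $\deg D=\sum a_i$; it is effective if all $a_i\ge 0$. The combinatorial Laplacian $\Delta(G)$ is the degree matrix minus the adjacency matrix; $\operatorname{Pic}(G)$ is the cokernel of $\Delta(G):\mathbb{Z}^n\to\mathbb{Z}^n$ (divisors modulo the image of the Laplacian; two divisors are linearly equivalent if they have the same class), and $\operatorname{Jac}(G)$ is the subgroup of $\operatorname{Pic}(G)$ of classes of degree $0$. The Baker–Norine rank $r(D)$ is $-1$ if $D$ is not linearly equivalent to an effective divisor, and otherwise the largest integer $r\ge 0$ such that for every effective divisor $E$ of degree $r$, $D-E$ is linearly equivalent to an effective divisor; it depends only on the class $[D]$. Set $h(D)=r(D)+1$. Lorenzini's two-variable zeta function is $Z_G(t,u)=\sum_{[D]\in\operatorname{Pic}(G)} \frac{u^{h(D)}-1}{u-1}\, t^{\deg D}$ (a rational function in $t,u$). *)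

(* Defs.v *)
From HB Require Import structures.
From mathcomp Require Import all_boot all_order all_algebra.
From mathcomp Require Import boolp classical_sets functions cardinality fsbigop.

Set Implicit Arguments.
Unset Strict Implicit.
Unset Printing Implicit Defensive.
Import Order.TTheory GRing.Theory Num.Theory.
Local Open Scope ring_scope.
Local Open Scope quotient_scope.

Record graph := Graph {
  nv : nat;
  adj : rel 'I_nv;
  adj_sym : symmetric adj;
  adj_irr : irreflexive adj;
  nv_gt0 : (0 < nv)%N;
  adj_connected : forall u v : 'I_nv, connect adj u v
}.

(* An edge {u, v} is represented by the ordered pair (u, v) with u < v. *)
Definition edges (G : graph) : {set 'I_(nv G) * 'I_(nv G)} :=
  [set e : 'I_(nv G) * 'I_(nv G) | (e.1 < e.2)%N && adj e.1 e.2].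

Definition edge_rel (G : graph) (A : {set 'I_(nv G) * 'I_(nv G)}) :
    rel 'I_(nv G) :=
  fun u v => ((u, v) \in A) || ((v, u) \in A).

Definition ncomp (G : graph) (A : {set 'I_(nv G) * 'I_(nv G)}) : nat :=
  n_comp (edge_rel A) predT.

(* Whitney's rank generating form; the variable x is the inner one ('X%:P)
   and y is the outer one ('X).  Both truncated subtractions are exact, since
   ncomp A >= ncomp (edges G) and ncomp A + #|A| >= nv G. *)
Definition tutte (G : graph) : {poly {poly int}} :=
  \sum_(A in powerset (edges G))
     ('X%:P - 1) ^+ (ncomp A - ncomp (edges G)) *
     ('X - 1) ^+ (ncomp A + #|A| - nv G).

Definition divisor (G : graph) := 'cV[int]_(nv G).

Definition div_deg (G : graph) (D : divisor G) : int := \sum_i D i ord0.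

Definition effective (G : graph) (D : divisor G) : bool :=
  [forall i, 0 <= D i ord0].

Definition vertex_deg (G : graph) (v : 'I_(nv G)) : nat := #|[set w | adj v w]|.

Definition laplacian (G : graph) : 'M[int]_(nv G) :=
  diag_mx (\row_i (vertex_deg i)%:Z) - \matrix_(i, j) (adj i j)%:R.

Definition principal (G : graph) : {pred divisor G} :=
  fun D => `[< exists f : 'cV[int]_(nv G), D = laplacian G *m f >].

Lemma principal_zmod_closed (G : graph) : zmod_closed (@principal G).
Proof.
split; first by apply/asboolP; exists 0; rewrite mulmx0.
move=> D E /asboolP[f ->] /asboolP[g ->].
by apply/asboolP; exists (f - g); rewrite mulmxBr.
Qed.

HB.instance Definition _ (G : graph) :=
  GRing.isZmodClosed.Build (divisor G) (@principal G)
    (principal_zmod_closed G).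

Definition Pic (G : graph) := Quotient.quot (@principal G).
HB.instance Definition _ (G : graph) := GRing.Zmodule.on (Pic G).

Definition lin_equiv (G : graph) (D E : divisor G) : bool :=
  D == E %[mod Pic G].

Lemma lin_equivP (G : graph) (D E : divisor G) :
  reflect (exists f, D - E = laplacian G *m f) (lin_equiv D E).
Proof. by rewrite /lin_equiv -Quotient.idealrBE; exact: asboolP. Qed.

Lemma div_deg_is_zmod_morphism (G : graph) : zmod_morphism (@div_deg G).
Proof.
by move=> D E; rewrite /div_deg -sumrB; apply: eq_bigr => i _; rewrite !mxE.
Qed.

HB.instance Definition _ (G : graph) :=
  GRing.isZmodMorphism.Build (divisor G) int (@div_deg G)
    (@div_deg_is_zmod_morphism G).

Lemma div_deg_principal (G : graph) (f : 'cV[int]_(nv G)) :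
  div_deg (laplacian G *m f : divisor G) = 0.
Proof.
rewrite /div_deg; under eq_bigr do rewrite mxE.
rewrite exchange_big /= big1 // => j _; rewrite -mulr_suml.
suff -> : \sum_i laplacian G i j = 0 by rewrite mul0r.
under eq_bigr do rewrite !mxE; rewrite sumrB (bigD1 j) //= eqxx mulr1n.
rewrite big1 ?addr0; last by move=> i /negPf->; rewrite mulr0n.
apply/eqP; rewrite subr_eq0 /vertex_deg; apply/eqP.
rewrite -sum1_card -natz natr_sum big_mkcond /=.
by apply: eq_bigr => i _; rewrite inE adj_sym; case: adj.
Qed.

Lemma lin_equiv_deg (G : graph) (D E : divisor G) :
  lin_equiv D E -> div_deg D = div_deg E.
Proof.
case/lin_equivP=> f e; apply/eqP; rewrite -subr_eq0 -raddfB /=.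
by rewrite e div_deg_principal.
Qed.

Definition pic_deg (G : graph) (c : Pic G) : int := div_deg (repr c).

Lemma pic_degE (G : graph) (D : divisor G) :
  pic_deg (\pi_(Pic G) D) = div_deg D.
Proof. by apply: lin_equiv_deg; rewrite /lin_equiv reprK. Qed.

Lemma pic_deg_is_zmod_morphism (G : graph) : zmod_morphism (@pic_deg G).
Proof.
move=> a b; rewrite -[a]reprK -[b]reprK.
by rewrite -raddfB /= !pic_degE raddfB.
Qed.

HB.instance Definition _ (G : graph) :=
  GRing.isZmodMorphism.Build (Pic G) int (@pic_deg G)
    (@pic_deg_is_zmod_morphism G).

Definition pic0 (G : graph) : {pred Pic G} := fun c => pic_deg c == 0.

Lemma pic0_zmod_closed (G : graph) : zmod_closed (@pic0 G).
Proof.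
split; first by rewrite unfold_in raddf0.
by move=> a b /eqP a0 /eqP b0; rewrite unfold_in raddfB /= a0 b0 subrr.
Qed.

HB.instance Definition _ (G : graph) :=
  GRing.isZmodClosed.Build (Pic G) (@pic0 G) (pic0_zmod_closed G).

Record Jac (G : graph) := MkJac { jac_val :> Pic G; _ : jac_val \in @pic0 G }.
HB.instance Definition _ (G : graph) := [isSub for @jac_val G].
HB.instance Definition _ (G : graph) := [Choice of Jac G by <:].
HB.instance Definition _ (G : graph) :=
  [SubChoice_isSubZmodule of Jac G by <:].

Definition winnable (G : graph) (D : divisor G) : Prop :=
  exists2 E : divisor G, effective E & lin_equiv D E.

Definition rank_ge (G : graph) (D : divisor G) (r : nat) : Prop :=
  forall E : divisor G, effective E -> div_deg E = r%:Z -> winnable (D - E).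

(* Any r with rank_ge D r is at most deg D, so the bounded maximum below
   ranges over all relevant r; see bn_rankP. *)
Definition bn_rank (G : graph) (D : divisor G) : int :=
  if `[< winnable D >]
  then (\max_(r < `|div_deg D|.+1 | `[< rank_ge D r >]) r)%:Z
  else -1.

Lemma effective_deg_ge0 (G : graph) (E : divisor G) :
  effective E -> 0 <= div_deg E.
Proof. by move=> /forallP e; apply: sumr_ge0. Qed.

Lemma winnable_equiv (G : graph) (D D' : divisor G) :
  lin_equiv D D' -> winnable D <-> winnable D'.
Proof.
by rewrite /lin_equiv => /eqP e; split=> -[E eE];
  rewrite /lin_equiv ?e -?e; exists E => //; rewrite /lin_equiv ?e -?e.
Qed.

Lemma rank_ge_deg (G : graph) (D : divisor G) (r : nat) :
  rank_ge D r -> r%:Z <= div_deg D.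
Proof.
pose v0 := Ordinal (nv_gt0 G).
pose E : divisor G := \col_i ((i == v0)%:R * r%:Z).
have dE : div_deg E = r%:Z.
  rewrite /div_deg (bigD1 v0) //= mxE eqxx mul1r big1 ?addr0 // => i /negPf h.
  by rewrite mxE h mul0r.
have eE : effective E by apply/forallP => i; rewrite mxE; case: eqP.
move=> /(_ E eE dE)[F /effective_deg_ge0 dF /lin_equiv_deg].
by rewrite raddfB /= dE => h; rewrite -subr_ge0 h.
Qed.

Lemma bn_rankP (G : graph) (D : divisor G) : winnable D ->
  exists r : nat,
    [/\ bn_rank D = r%:Z, rank_ge D r & forall s, rank_ge D s -> (s <= r)%N].
Proof.
move=> wD; rewrite /bn_rank asboolT //; eexists; split; first by [].
- have h0 : `[< rank_ge D (@ord0 `|div_deg D|) >].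
    apply/asboolP => E /forallP eE dE; suff -> : E = 0 by rewrite subr0.
    have /psumr_eq0P h : \sum_i E i ord0 = 0 by rewrite -[LHS]/(div_deg E) dE.
    by apply/matrixP => i j; rewrite ord1 mxE h.
  pose P := [pred r : 'I_(`|div_deg D|.+1) | `[< rank_ge D r >]].
  have P0 : (0 < #|P|)%N by apply/card_gt0P; exists ord0.
  by have [i /asboolP hi ->] := eq_bigmax_cond (fun r => nat_of_ord r) P0.
move=> s hs; have sD := rank_ge_deg hs.
have lt_s : (s < `|div_deg D|.+1)%N.
  by rewrite ltnS -lez_nat gez0_abs // (le_trans _ sD).
by apply: (@leq_bigmax_cond _ _ _ (Ordinal lt_s)); apply/asboolP.
Qed.

Lemma bn_rank_unwinnable (G : graph) (D : divisor G) :
  ~ winnable D -> bn_rank D = -1.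
Proof. by move=> h; rewrite /bn_rank asboolF. Qed.

Lemma bn_rank_equiv (G : graph) (D D' : divisor G) :
  lin_equiv D D' -> bn_rank D = bn_rank D'.
Proof.
move=> e; rewrite /bn_rank (asbool_equiv_eq (winnable_equiv e)).
rewrite (lin_equiv_deg e); case: ifP => // _; congr (Posz _).
apply: eq_bigl => r; apply: asbool_equiv_eq.
suff eE E : winnable (D - E) <-> winnable (D' - E).
  by split=> h E eE0 dE; apply/eE; apply: h.
apply: winnable_equiv; case/lin_equivP: e => f e.
by apply/lin_equivP; exists f; rewrite opprB addrA addrNK.
Qed.

Definition h_val (G : graph) (D : divisor G) : nat := absz (bn_rank D + 1)%R.

Definition pic_h (G : graph) (c : Pic G) : nat := h_val (repr c).

Lemma pic_hE (G : graph) (D : divisor G) : pic_h (\pi_(Pic G) D) = h_val D.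
Proof.
by rewrite /pic_h /h_val (@bn_rank_equiv _ (repr _) D) // /lin_equiv reprK.
Qed.

(* (u^h - 1) / (u - 1) as a polynomial in u = 'X; the division is exact. *)
Definition u_quot (h : nat) : {poly int} := ('X ^+ h - 1) %/ ('X - 1).

(* The formal Laurent series in t given by Lorenzini's sum: zeta G d is the
   coefficient of t^d, a polynomial in u.  By zeta_finite_support only finitely
   many classes of degree d contribute, so the finitely supported sum is the
   sum over all of them. *)
Definition zeta (G : graph) (d : int) : {poly int} :=
  \sum_(c \in [set c : Pic G | pic_deg c = d]%classic)
     u_quot (pic_h c).

Lemma u_quotE (h : nat) : u_quot h = \sum_(i < h) 'X ^+ i.
Proof.
by rewrite /u_quot subrX1 mulrC Pdiv.IdomainMonic.mulpK // -[1]polyC1 monicXsubC.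
Qed.

Lemma zeta_finite_support (G : graph) (d : int) :
  finite_set [set c : Pic G | pic_deg c = d /\ u_quot (pic_h c) != 0]%classic.
Proof.
pose F (g : {ffun 'I_(nv G) -> 'I_(`|d|.+1)}) : Pic G :=
  \pi_(Pic G) (\col_i (g i)%:Z : divisor G).
apply: (@sub_finite_set _ _ (range F)); last first.
  by apply: finite_image; exact: finite_finset.
move=> c [cd]; rewrite u_quotE => h0.
have [[E /forallP eE cE]|nw] := pselect (winnable (repr c)); last first.
  by move: h0; rewrite /pic_h /h_val bn_rank_unwinnable // big_ord0 eqxx.
have dE : div_deg E = d by rewrite -cd; apply/esym/lin_equiv_deg.
have lE i : (`|E i ord0| < `|d|.+1)%N.
  rewrite ltnS -lez_nat !gez0_abs //; last first.
    by rewrite -dE; apply: effective_deg_ge0; apply/forallP.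
  by rewrite -dE /div_deg (bigD1 i) //= lerDl sumr_ge0.
exists [ffun i => Ordinal (lE i)] => //.
rewrite /F -[RHS]reprK (eqP cE); congr (\pi _).
apply/matrixP => i j; rewrite (ord1 j) !mxE ffunE /= gez0_abs //; congr (E i _).
Qed.

(* Main.v *)
Require Import Defs.
From HB Require Import structures.
From mathcomp Require Import all_boot all_order all_algebra.
From mathcomp Require Import boolp classical_sets functions cardinality fsbigop.

Set Implicit Arguments.
Unset Strict Implicit.
Unset Printing Implicit Defensive.
Import Order.TTheory GRing.Theory Num.Theory.
Local Open Scope ring_scope.
Local Open Scope quotient_scope.

(** Glue a triangle at one vertex v of the diamond K_4 - e.  The Tutte
    polynomial and the Jacobian of such a wedge do not depend on v.  The
    diamond has genus 2, with canonical class e_0 + e_1, where 0 and 1 are its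
    vertices of degree 3; the wedge has a divisor of degree 2 and rank 1 exactly
    when 2 e_v is canonical on the diamond.  This holds for v = 2, of degree 2
    (fire v), and fails for v = 0.  The coefficient of t^2 u in the zeta function
    counts the classes of degree 2 and rank at least 1, so it separates the two
    wedges. *)

(** * Graphs given by edge lists, with computable connected components *)

Implicit Types es : seq (nat * nat).

Definition list_rel n es : rel 'I_n :=
  fun u v => ((u : nat, v : nat) \in es) || ((v : nat, u : nat) \in es).

(** Union-find by recursion on the edges: an edge [(u, v)] merges the class of [v] into that of [u].
    Being computable, it replaces [connect] when components are counted. *)
Fixpoint label es : nat -> nat :=
  if es is (u, v) :: es' then
    let l := label es' in let a := l u in let b := l v in
    fun x => let c := l x in if c == b then a else c
  else id.

Definition in_range n es := all (fun p => p.1 < p.2 < n)%N es.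

Lemma list_rel_sym n es : symmetric (@list_rel n es).
Proof. by move=> u v; rewrite /list_rel orbC. Qed.

Lemma connect_invariant (T : finType) (S : Type) (e : rel T) (f : T -> S) x y :
  (forall u v, e u v -> f u = f v) -> connect e x y -> f x = f y.
Proof.
move=> ef /connectP[p + ->]; elim: p x => //= z p IH x /andP[/ef -> /IH].
exact.
Qed.

Lemma label_connect n es (x y : 'I_n) : in_range n es ->
  (label es x == label es y) = connect (list_rel es) x y.
Proof.
elim: es x y => [|[u v] es IH] x y /=.
  move=> _; apply/eqP/idP => [/val_inj -> //|].
  exact: (@connect_invariant _ _ _ (@nat_of_ord n)).
move=> /andP[/andP[uv vn] rg]; have un := ltn_trans uv vn.
pose u' := Ordinal un; pose v' := Ordinal vn.
have symc := sym_connect_sym (@list_rel_sym n ((u, v) :: es)).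
have sub (a b : 'I_n) : label es a == label es b ->
    connect (list_rel ((u, v) :: es)) a b.
  rewrite IH //; apply: connect_sub => a' b' ab; apply: connect1.
  by move: ab; rewrite /list_rel !inE => /orP[] ->; rewrite !orbT.
have cuv : connect (list_rel ((u, v) :: es)) u' v'.
  by apply: connect1; rewrite /list_rel inE eqxx.
apply/idP/idP.
  (* Only the class of [v] is relabelled, so the cases are whether [x] and [y] lie in it; a mixed
     case crosses the new edge once. *)
  have [xv|_] := eqVneq (label es x) (label es v);
    have [yv|_] := eqVneq (label es y) (label es v).
  - by move=> _; apply: sub; rewrite xv yv.
  - move=> uy; apply: (connect_trans (y := v')); first by apply: sub; rewrite xv.
    rewrite symc in cuv.
    by apply: connect_trans cuv _; apply: sub.
  - move=> xu; apply: (connect_trans (y := u')); first exact: sub.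
    by apply: connect_trans cuv _; apply: sub; rewrite yv.
  - exact: sub.
(* Conversely, labels are constant along each edge, hence along paths. *)
move=> cxy; apply/eqP; move: cxy.
apply: (connect_invariant (f := label ((u, v) :: es) \o @nat_of_ord n)) => a b /=.
rewrite /list_rel !inE => /orP[/orP[/eqP[-> ->]|ab]|/orP[/eqP[-> ->]|ab]].
- by rewrite eqxx; case: (label es u == _).
- suff /eqP -> : label es a == label es b by [].
  by rewrite IH // connect1 // /list_rel ab.
- by rewrite eqxx; case: (label es u == _).
- suff /eqP -> : label es a == label es b by [].
  by rewrite IH // connect1 // /list_rel ab orbT.
Qed.

(** Each component has exactly one root, so the values of [f] at the roots list each value of [f]
    once. *)
Lemma n_comp_fibers (T : finType) (S : eqType) (e : rel T) (f : T -> S) :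
  connect_sym e -> (forall x y, (f x == f y) = connect e x y) ->
  n_comp e predT = size (undup (map f (enum T))).
Proof.
move=> syme fe; rewrite /n_comp_mem.
set A := (X in #|X|); have inA x : (x \in A) = roots e x by rewrite !inE andbT.
rewrite cardE -(size_map f); apply: perm_size; apply: uniq_perm.
- rewrite map_inj_in_uniq ?enum_uniq // => x y; rewrite !mem_enum !inA.
  move=> /eqP rx /eqP ry /eqP; rewrite fe -(root_connect syme) => /eqP.
  by rewrite rx ry.
- exact: undup_uniq.
move=> s; rewrite mem_undup; apply/mapP/mapP => -[x xA ->].
  by exists x; rewrite // mem_enum.
exists (fingraph.root e x); first by rewrite mem_enum inA roots_root.
by apply/eqP; rewrite fe connect_root.
Qed.

Definition n_labels n es := size (undup (map (label es) (iota 0 n))).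

Lemma n_comp_list n es : in_range n es ->
  n_comp (@list_rel n es) predT = n_labels n es.
Proof.
move=> rg; rewrite (@n_comp_fibers _ _ _ (label es \o @nat_of_ord n)).
- by rewrite /n_labels map_comp val_enum_ord.
- exact: sym_connect_sym (@list_rel_sym n es).
- by move=> x y; rewrite label_connect.
Qed.

(** A constant label encodes connectedness; the strict order in [in_range] excludes loops and
    matches the orientation chosen in [edges]. *)
Definition well_formed n es :=
  [&& (0 < n)%N, in_range n es &
      all (fun x => label es x == label es 0) (iota 0 n)].

Section ListGraph.
Variables (n : nat) (es : seq (nat * nat)).
Hypothesis wf : well_formed n es.

Lemma list_rel_irr : irreflexive (@list_rel n es).
Proof.
move=> x; apply/negbTE; rewrite /list_rel orbb; apply/negP => xx.
by case/and3P: wf => _ /allP /(_ _ xx) /=; rewrite ltnn.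
Qed.

Lemma list_rel_connected (u v : 'I_n) : connect (@list_rel n es) u v.
Proof.
case/and3P: wf => _ rg /allP h; rewrite -label_connect //.
have lE (x : 'I_n) : label es x = label es 0.
  by apply/eqP/h; rewrite mem_iota add0n ltn_ord.
by rewrite !lE.
Qed.

Lemma list_size_gt0 : (0 < n)%N.
Proof. by case/and3P: wf. Qed.

Definition list_graph : graph :=
  Graph (@list_rel_sym n es) list_rel_irr list_size_gt0 list_rel_connected.

Lemma in_edges_list (p : 'I_n * 'I_n) :
  (p \in edges list_graph) = ((p.1 : nat, p.2 : nat) \in es).
Proof.
rewrite inE /= /list_rel; apply/andP/idP => [[lt /orP[//|gt]]|h].
  case/and3P: wf => _ /allP /(_ _ gt) /andP[/= gt' _] _.
  by move: (ltn_trans lt gt'); rewrite ltnn.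
by rewrite h; case/and3P: wf => _ /allP /(_ _ h) /andP[].
Qed.

End ListGraph.

(** * Enumeration of edge subsets and the Tutte polynomial *)

Fixpoint sublists (T : Type) (s : seq T) : seq (seq T) :=
  if s is x :: s' then sublists s' ++ map (cons x) (sublists s') else [:: [::]].

Section Sublists.
Variable T : eqType.
Implicit Types s t : seq T.

Lemma mem_sublists s t : t \in sublists s -> subseq t s.
Proof.
elim: s t => [|x s IH] t /=; first by rewrite inE.
rewrite mem_cat => /orP[/IH ts|/mapP[t' /IH ts ->]].
  exact: subseq_trans ts (subseq_cons s x).
by rewrite eqxx.
Qed.

Lemma filter_sublists (a : pred T) s : filter a s \in sublists s.
Proof.
elim: s => //= x s IH; rewrite mem_cat; case: (a x); last by rewrite IH.
by rewrite (map_f (cons x)) ?orbT.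
Qed.

Lemma sublists_uniq s : uniq s -> uniq (sublists s).
Proof.
elim: s => //= x s IH /andP[xs us]; rewrite cat_uniq IH //=.
apply/andP; split; last by rewrite map_inj_uniq ?IH // => ? ? [].
apply/hasPn => _ /mapP[t _ ->]; apply: contra xs => /mem_sublists /mem_subseq.
by apply; rewrite inE eqxx.
Qed.
End Sublists.

Section Tutte.
Variables (n : nat) (es : seq (nat * nat)).
Hypothesis wf : well_formed n es.

Definition nat_pair (p : 'I_n * 'I_n) : nat * nat := (p.1 : nat, p.2 : nat).

Lemma nat_pair_inj : injective nat_pair.
Proof. by move=> [a b] [c d] [/val_inj -> /val_inj ->]. Qed.

Definition edge_set (s : seq (nat * nat)) : {set 'I_n * 'I_n} :=
  [set p | nat_pair p \in s].

Lemma list_in_range s : s \in sublists es -> in_range n s.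
Proof.
move=> /mem_sublists /mem_subseq ss; have /and3P[_ /allP rg _] := wf.
by apply/allP => p /ss /rg.
Qed.

Lemma powerset_edges_list : uniq es ->
  perm_eq (enum (powerset (edges (list_graph wf)))) (map edge_set (sublists es)).
Proof.
move=> ues; apply: uniq_perm; first exact: enum_uniq.
  rewrite map_inj_in_uniq ?sublists_uniq // => s t sS tS /setP st.
  (* A sublist of a duplicate-free list is recovered by filtering on membership, which makes
     [edge_set] injective on sublists. *)
  have sE r : r \in sublists es -> r = [seq p <- es | p \in r].
    by move=> /mem_sublists; apply: subseq_uniqP.
  rewrite (sE _ sS) (sE _ tS); apply: eq_in_filter => -[u v] uv.
  case/and3P: (wf) => _ /allP /(_ _ uv) /andP[/= lt vn] _.
  by have := st (Ordinal (ltn_trans lt vn), Ordinal vn); rewrite !inE.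
move=> A; rewrite mem_enum powersetE; apply/idP/mapP => [/fintype.subsetP AE|[s sS ->]].
  exists [seq p <- es | p \in [seq nat_pair q | q in A]].
    exact: filter_sublists.
  apply/setP => p; rewrite inE mem_filter fintype.mem_image; last exact: nat_pair_inj.
  by apply/idP/andP => [pA|[]//]; rewrite -(in_edges_list wf) AE.
apply/fintype.subsetP => p; rewrite inE in_edges_list.
by move/mem_sublists/mem_subseq: sS => /[apply].
Qed.

Lemma card_edge_set s : s \in sublists es -> uniq es -> #|edge_set s| = size s.
Proof.
move=> sS ues; have us := subseq_uniq (mem_sublists sS) ues.
rewrite cardE -(size_map nat_pair); apply: perm_size; apply: uniq_perm => //.
  by rewrite map_inj_uniq ?enum_uniq //; exact: nat_pair_inj.
move=> [u v]; apply/mapP/idP => [[p + ->]|uv]; first by rewrite mem_enum inE.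
case/andP: (allP (list_in_range sS) _ uv) => /= lt vn.
by exists (Ordinal (ltn_trans lt vn), Ordinal vn); rewrite // mem_enum inE.
Qed.

Lemma ncomp_edge_set s : s \in sublists es ->
  @ncomp (list_graph wf) (edge_set s) = n_labels n s.
Proof.
move=> sS; rewrite -(n_comp_list (list_in_range sS)); apply: eq_n_comp.
by apply: eq_connect => u v; rewrite /edge_rel !inE.
Qed.

(** The rank generating form sees an edge subset only through its number of components and its size,
    so the list of these pairs determines the polynomial. *)
Lemma tutte_list : uniq es -> tutte (list_graph wf) =
  \sum_(p <- [seq (n_labels n s, size s) | s <- sublists es])
    ('X%:P - 1) ^+ (p.1 - n_labels n es) * ('X - 1) ^+ (p.1 + p.2 - n).
Proof.
move=> ues; have esS : es \in sublists es.
  by have := filter_sublists predT es; rewrite filter_predT.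
have -> : n_labels n es = ncomp (edges (list_graph wf)).
  rewrite -(ncomp_edge_set esS); congr ncomp.
  by apply/setP => p; rewrite in_edges_list inE.
rewrite /tutte -big_enum (perm_big _ (powerset_edges_list ues)) !big_map.
rewrite [LHS]big_seq [RHS]big_seq; apply: eq_bigr => s sS.
by rewrite ncomp_edge_set // card_edge_set.
Qed.
End Tutte.

(** * The two wedges and their common Tutte polynomial *)

Definition diamond := [:: (0, 1); (0, 2); (0, 3); (1, 2); (1, 3)]%N.

Definition diamond_triangle (v : nat) :=
  (diamond ++ [:: (v, 4); (v, 5); (4, 5)])%N.

Lemma diamond_triangle_wf v : (v < 4)%N -> well_formed 6 (diamond_triangle v).
Proof. by case: v => [|[|[|[|]]]]. Qed.

Definition G0 : graph := list_graph (diamond_triangle_wf (isT : 0 < 4)%N).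
Definition G2 : graph := list_graph (diamond_triangle_wf (isT : 2 < 4)%N).

Lemma tutte_eq : tutte G2 = tutte G0.
Proof.
rewrite (tutte_list _ (isT : uniq (diamond_triangle 2))).
rewrite (tutte_list _ (isT : uniq (diamond_triangle 0))).
(* The lists agree even in order: a subset of a wedge has the components of its two parts, with one
   merged pair, wherever the gluing takes place. *)
have -> : [seq (n_labels 6 s, size s) | s <- sublists (diamond_triangle 2)] =
          [seq (n_labels 6 s, size s) | s <- sublists (diamond_triangle 0)].
  by vm_compute.
have -> : n_labels 6 (diamond_triangle 2) = n_labels 6 (diamond_triangle 0).
  by vm_compute.
by [].
Qed.

(** * Isomorphisms of Jacobians from integer matrices *)

Section PicMap.
Variables (G G' : graph) (P : 'M[int]_(nv G', nv G)) (M : 'M[int]_(nv G', nv G)).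
Hypothesis PL : P *m laplacian G = laplacian G' *m M.
Hypothesis P_deg : forall D : divisor G, div_deg (P *m D : divisor G') = div_deg D.

Definition pic_map (c : Pic G) : Pic G' := \pi_(Pic G') (P *m repr c : divisor G').

(** By [PL], the matrix [P] sends principal divisors to principal divisors, so the chosen
    representative does not matter. *)
Lemma pic_mapE (D : divisor G) :
  pic_map (\pi_(Pic G) D) = \pi_(Pic G') (P *m D : divisor G').
Proof.
apply/eqP; rewrite /pic_map -/(lin_equiv _ _); apply/lin_equivP.
have /lin_equivP[f e] : lin_equiv (repr (\pi_(Pic G) D)) D.
  by rewrite /lin_equiv reprK.
by exists (M *m f); rewrite -mulmxBr e !mulmxA PL.
Qed.

Lemma pic_map_is_zmod_morphism : zmod_morphism pic_map.
Proof.
move=> a b; rewrite -[a]reprK -[b]reprK -raddfB /= !pic_mapE mulmxBr.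
by rewrite raddfB.
Qed.

HB.instance Definition _ :=
  GRing.isZmodMorphism.Build (Pic G) (Pic G') pic_map pic_map_is_zmod_morphism.

Lemma pic_map_deg c : pic_deg (pic_map c) = pic_deg c.
Proof. by rewrite -[c]reprK pic_mapE !pic_degE P_deg. Qed.

Lemma pic_map_jac (c : Jac G) : pic_map (jac_val c) \in @pic0 G'.
Proof. by rewrite unfold_in pic_map_deg; exact: (valP c). Qed.

Definition jac_map (c : Jac G) : Jac G' := MkJac (pic_map_jac c).

Lemma jac_map_is_zmod_morphism : zmod_morphism jac_map.
Proof. by move=> a b; apply: val_inj; rewrite /= !raddfB. Qed.

HB.instance Definition _ :=
  GRing.isZmodMorphism.Build (Jac G) (Jac G') jac_map jac_map_is_zmod_morphism.

End PicMap.

Lemma jac_iso (G G' : graph) (P M : 'M[int]_(nv G', nv G))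
    (Q N : 'M[int]_(nv G, nv G')) :
    P *m laplacian G = laplacian G' *m M ->
    Q *m laplacian G' = laplacian G *m N ->
    (forall D : divisor G, div_deg (P *m D : divisor G') = div_deg D) ->
    P *m Q = 1%:M -> Q *m P = 1%:M ->
  exists f : {additive Jac G -> Jac G'}, bijective f.
Proof.
move=> PL QL Pdeg PQ QP.
have Qdeg (D : divisor G') : div_deg (Q *m D : divisor G) = div_deg D.
  by rewrite -Pdeg mulmxA PQ mul1mx.
exists (jac_map PL Pdeg); exists (jac_map QL Qdeg) => c; apply: val_inj => /=;
  rewrite -[jac_val c]reprK.
- by rewrite (pic_mapE PL) (pic_mapE QL) mulmxA QP mul1mx.
- by rewrite (pic_mapE QL) (pic_mapE PL) mulmxA PQ mul1mx.
Qed.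

(** * Matrix identities checked by computation, and the isomorphism of Jacobians *)

Definition fun_mx m n (F : nat -> nat -> int) : 'M[int]_(m, n) :=
  \matrix_(i, j) F i j.

(** The matrix product as a fold over [iota], a form that [vm_compute] evaluates, so that matrix
    identities become boolean tests. *)
Definition fun_mul n (F H : nat -> nat -> int) (i j : nat) : int :=
  foldr +%R 0 [seq F i k * H k j | k <- iota 0 n].

Definition eqb_fun m n (F H : nat -> nat -> int) :=
  all (fun i => all (fun j => F i j == H i j) (iota 0 n)) (iota 0 m).

Lemma fun_mxM m n p F H :
  fun_mx m n F *m fun_mx n p H = fun_mx m p (fun_mul n F H).
Proof.
apply/matrixP => i j; rewrite !mxE /fun_mul foldrE big_map.
have -> : iota 0 n = index_iota 0 n by rewrite /index_iota subn0.
by rewrite big_mkord; apply: eq_bigr => k _; rewrite !mxE.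
Qed.

Lemma eq_fun_mx m n F H : eqb_fun m n F H -> fun_mx m n F = fun_mx m n H.
Proof.
move=> /allP FH; apply/matrixP => i j; rewrite !mxE; apply/eqP.
have /FH /allP FHi : (i : nat) \in iota 0 m by rewrite mem_iota add0n ltn_ord.
by apply: FHi; rewrite mem_iota add0n ltn_ord.
Qed.

Lemma one_fun_mx n : 1%:M = fun_mx n n (fun i j => (i == j)%:R).
Proof. by apply/matrixP => i j; rewrite !mxE. Qed.

Definition adjb es (u v : nat) := ((u, v) \in es) || ((v, u) \in es).

Definition lap n es (i j : nat) : int :=
  (count (adjb es i) (iota 0 n))%:Z *+ (i == j) - (adjb es i j)%:R.

Lemma laplacian_list n es (wf : well_formed n es) :
  laplacian (list_graph wf) = fun_mx n n (lap n es).
Proof.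
apply/matrixP => i j; rewrite !mxE; congr (_ *+ _ - _).
rewrite /vertex_deg cardsE cardE /enum_mem size_filter -enumT /=.
rewrite -val_enum_ord count_map; congr Posz; exact: eq_count.
Qed.

(* Sends [e_j] to [e_j + e_a - e_b] for the two triangle vertices [j = 4, 5]
   and fixes the diamond: this identifies the degree-0 divisors of both wedges
   with pairs of degree-0 divisors on the diamond and on the triangle. *)
Definition transfer (a b i j : nat) : int :=
  (i == j)%:R + (3 < j)%:R * ((i == a)%:R - (i == b)%:R).

Lemma jac_G2_G0 : exists f : {additive Jac G2 -> Jac G0}, bijective f.
Proof.
(* With [P] the first transfer matrix and [Q] its inverse, the Laplacians are congruent: that of
   [G0] is [P] times that of [G2] times the transpose of [P]. Hence [M] and [N] are the transposes
   of [Q] and [P]. *)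
apply: (@jac_iso G2 G0 (fun_mx 6 6 (transfer 2 0))
  (fun_mx 6 6 (fun i j => transfer 0 2 j i)) (fun_mx 6 6 (transfer 0 2))
  (fun_mx 6 6 (fun i j => transfer 2 0 j i))).
- by rewrite !laplacian_list !fun_mxM; apply: eq_fun_mx; vm_compute.
- by rewrite !laplacian_list !fun_mxM; apply: eq_fun_mx; vm_compute.
- move=> D.
  (* The degree is multiplication by the all-ones row, so its preservation is also a matrix
     identity. *)
  have degE (G : graph) (E : divisor G) :
      div_deg E = (fun_mx 1 (nv G) (fun _ _ => 1) *m E) ord0 ord0.
    by rewrite mxE; apply: eq_bigr => i _; rewrite mxE mul1r.
  rewrite !degE mulmxA fun_mxM; congr ((_ *m _) _ _).
  by apply: eq_fun_mx; vm_compute.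
- by rewrite one_fun_mx fun_mxM; apply: eq_fun_mx; vm_compute.
- by rewrite one_fun_mx fun_mxM; apply: eq_fun_mx; vm_compute.
Qed.

(** * Rank at least one and the coefficient of [u] in the zeta function *)

Section UnitDivisors.
Variable G : graph.
Implicit Types (D E : divisor G) (v : 'I_(nv G)).

Definition unit_div v : divisor G := delta_mx v ord0.

Lemma unit_div_effective v : effective (unit_div v).
Proof. by apply/forallP => i; rewrite mxE; case: (_ && _). Qed.

Lemma unit_div_deg v : div_deg (unit_div v) = 1.
Proof.
rewrite /div_deg (bigD1 v) //= mxE !eqxx big1 ?addr0 // => i /negPf iv.
by rewrite mxE iv.
Qed.

Lemma effective_deg0 E : effective E -> div_deg E = 0 -> E = 0.
Proof.
move=> /forallP eE dE.
have /psumr_eq0P h : \sum_i E i ord0 = 0 by rewrite -[LHS]/(div_deg E) dE.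
by apply/matrixP => i j; rewrite ord1 mxE h.
Qed.

Lemma effective_deg1 E : effective E -> div_deg E = 1 -> exists v, E = unit_div v.
Proof.
move=> /forallP eE dE.
have [[v Ev]|E0] := pselect (exists v, E v ord0 != 0); last first.
  move: dE; rewrite /div_deg big1 // => i _; apply/eqP; apply: contra_notT E0.
  by exists i.
exists v; apply/eqP; rewrite -subr_eq0; apply/eqP; apply: effective_deg0.
  apply/forallP => i; rewrite !mxE; case: eqP => [->|_] /=; last by rewrite subr0.
  by rewrite subr_ge0 -gtz0_ge1 lt_neqAle eq_sym Ev /=.
by rewrite raddfB /= dE unit_div_deg subrr.
Qed.

Lemma rank_ge1 D : (forall v, winnable (D - unit_div v)) -> rank_ge D 1.
Proof. by move=> wD E eE /(effective_deg1 eE) [v ->]. Qed.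

Lemma winnable_addr D E : effective E -> winnable D -> winnable (D + E).
Proof.
move=> /forallP eE [F /forallP eF /lin_equivP[f DF]]; exists (F + E).
  by apply/forallP => i; rewrite mxE addr_ge0.
by apply/lin_equivP; exists f; rewrite opprD addrACA subrr addr0.
Qed.

(** Remove [r.+1] chips at [v], then put [r] of them back: adding chips keeps a divisor winnable. *)
Lemma rank_geS_winnable D r v : rank_ge D r.+1 -> winnable (D - unit_div v).
Proof.
have eff k : effective (unit_div v *+ k).
  apply/forallP => i; rewrite mulmxnE mulrn_wge0 //.
  exact: (forallP (unit_div_effective v)).
move=> /(_ _ (eff r.+1)); rewrite raddfMn /= unit_div_deg natz => /(_ erefl).
move/(winnable_addr (eff r)); congr winnable.
by rewrite mulrS opprD addrA subrK.
Qed.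

Lemma h_val_gt1P D :
  reflect (forall v, winnable (D - unit_div v)) (1 < h_val D)%N.
Proof.
apply: (iffP idP) => [|wD].
  rewrite /h_val; have [wD|nD] := pselect (winnable D); last first.
    by rewrite bn_rank_unwinnable.
  have [[|r] [-> rD _]] := bn_rankP wD; first by [].
  by move=> _ v; apply: rank_geS_winnable rD.
have wD0 : winnable D.
  pose v0 : 'I_(nv G) := Ordinal (nv_gt0 G).
  by have := winnable_addr (unit_div_effective v0) (wD v0); rewrite subrK.
have [r [rE _ rmax]] := bn_rankP wD0.
by rewrite /h_val rE -PoszD absz_nat addn1 ltnS rmax //; exact: rank_ge1.
Qed.

Lemma u_quot_coef1 h : (u_quot h)`_1 = (1 < h)%:R.
Proof.
rewrite u_quotE coef_sum; under eq_bigr do rewrite coefXn.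
case: h => [|[|h]]; first by rewrite big_ord0.
  by rewrite big_ord1.
by rewrite 2!big_ord_recl big1 ?addr0 // => i _.
Qed.

(** Each class of degree [d] contributes 1 if its rank is at least 1 and 0 otherwise; a sum of
    nonnegative terms vanishes only if every term does. *)
Lemma zeta_coef1_eq0P (d : int) :
  (zeta G d)`_1 = 0 <->
  forall D, div_deg D = d -> exists v, ~ winnable (D - unit_div v).
Proof.
rewrite /zeta coef_sum; set F := fun c : Pic G => u_quot (pic_h c).
set A := [set c | _]%classic.
(* Finiteness matters: over an infinite support the sum would be 0 by default. *)
have finF : finite_set (A `&` F @^-1` [set~ 0])%classic.
  apply: sub_finite_set (zeta_finite_support G d) => c [/= cd F0].
  by split=> //; apply/eqP.
under eq_bigr do rewrite u_quot_coef1.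
split=> [+ D dD|nw]; last first.
  rewrite big_seq big1 // => c; rewrite in_finite_support // inE => -[cd _].
  have [v wv] := nw (repr c) cd.
  by case: (h_val_gt1P (repr c)) => // /(_ v).
have [//|nv] := pselect (exists v, ~ winnable (D - unit_div v)).
have hD : (1 < pic_h (\pi_(Pic G) D))%N.
  rewrite pic_hE; apply/h_val_gt1P => v.
  by have [//|wv] := pselect (winnable (D - unit_div v)); case: nv; exists v.
have inS : \pi_(Pic G) D \in finite_support 0 A F.
  rewrite in_finite_support // inE; split; first by rewrite /A /= pic_degE.
  move=> /= /(congr1 (fun p : {poly int} => p`_1)) /eqP.
  by rewrite u_quot_coef1 hD coef0.
rewrite (bigD1_seq _ inS) ?finite_support_uniq //= => /eqP.
by rewrite hD gt_eqF // ltr_pwDl // sumr_ge0 // => c _; exact: ler0n.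
Qed.

End UnitDivisors.

(** * Separation of the two zeta functions *)

(** Here [F] is a firing script turning [D] into one chip at [v] and one at [w]; removing the chip
    at [v] leaves an effective divisor. *)
Lemma winnable_unit (n : nat) es (wf : well_formed n es)
    (D F : nat -> nat -> int) (v w : 'I_n) :
    eqb_fun n 1 (fun i j => D i j - (i == v)%:R - (i == w)%:R)
      (fun_mul n (lap n es) F) ->
  @winnable (list_graph wf) (fun_mx n 1 D - unit_div (G := list_graph wf) v).
Proof.
move=> DF; exists (unit_div (G := list_graph wf) w).
  exact: unit_div_effective.
apply/lin_equivP; exists (fun_mx n 1 F).
rewrite laplacian_list fun_mxM -(eq_fun_mx DF).
by apply/matrixP => i j; rewrite !mxE ord1 !andbT.
Qed.

Definition deg2_G2 (i j : nat) : int := (i == 2%N)%:R *+ 2.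

(* [2 e_2] is equivalent to [e_0 + e_1], to [2 e_3] and to [e_4 + e_5]. *)
Lemma winnable_G2 (v : 'I_(nv G2)) :
  @winnable G2 (fun_mx 6 1 deg2_G2 - unit_div v).
Proof.
(* [w x] is the second chip when the first is at [x]. The scripts fire 2 together with 4 and 5, so
   that nothing moves along the triangle; for [x = 3] also borrow at 3; for [x = 4, 5] fire the
   whole diamond. Missing entries default to 0. *)
pose w (x : nat) := nth 0%N [:: 1; 0; 2; 3; 5; 4]%N x.
pose F (x i _ : nat) : int := nth 0 (nth [::]
  [:: [:: 0; 0; 1; 0; 1; 1]; [:: 0; 0; 1; 0; 1; 1]; [::];
      [:: 0; 0; 1; - 1; 1; 1]; [:: 1; 1; 1; 1]; [:: 1; 1; 1; 1]] x) i.
apply: (@winnable_unit 6 _ _ deg2_G2 (F v) v (inord (w v))).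
by rewrite inordK; case: v => -[|[|[|[|[|[|]]]]]].
Qed.

(* Weights of a homomorphism [Pic G0 -> Z/24]: the residues mod 8 come from the
   diamond and those mod 3 from the triangle. *)
Definition char0 (_ i : nat) : int := nth 0 [:: 0; 18; 9; 21; 16; 8] i.

Lemma char0_principal (f : 'cV[int]_6) :
  exists k : int, (fun_mx 1 6 char0 *m (laplacian G0 *m f)) ord0 ord0 = k * 24.
Proof.
(* [K] is the row [char0] times the Laplacian of [G0], divided by 24. *)
pose K (_ j : nat) : int := nth 0 [:: - 3; 1; 0; 1; 1; 0] j.
exists ((fun_mx 1 6 K *m f) ord0 ord0).
rewrite mulmxA laplacian_list fun_mxM.
have -> : fun_mx 1 6 (fun_mul 6 char0 (lap 6 (diamond_triangle 0))) =
          24 *: fun_mx 1 6 K.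
  have -> : 24 *: fun_mx 1 6 K = fun_mx 1 6 (fun i j => 24 * K i j).
    by apply/matrixP => i j; rewrite !mxE.
  by apply: eq_fun_mx; vm_compute.
by rewrite -scalemxAl mxE mulrC.
Qed.

(** Otherwise [D] would be equivalent, for every [v], to a sum of two unit divisors including the
    one at [v]; applying the character mod 24 leaves finitely many residues to exclude. *)
Lemma unwinnable_G0 (D : divisor G0) :
  div_deg D = 2 -> exists v, ~ winnable (D - unit_div v).
Proof.
move=> dD; have [//|allw] := pselect (exists v, ~ winnable (D - unit_div v)).
pose chi (E : divisor G0) : int := (fun_mx 1 6 char0 *m E) ord0 ord0.
have chiB (E F : divisor G0) : chi (E - F) = chi E - chi F by rewrite /chi mulmxBr !mxE.
have chi_unit v : chi (unit_div v) = char0 0 v.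
  rewrite /chi mxE (bigD1 v) //= big1 ?addr0; first by rewrite !mxE !eqxx mulr1.
  by move=> i /negPf iv; rewrite !mxE iv mulr0.
have chi_equiv (v : 'I_(nv G0)) : exists w : 'I_6,
    (chi D = (char0 0 v + char0 0 w) %[mod 24])%Z.
  have [[E eE DE]|] := pselect (winnable (D - unit_div v)); last first.
    by move=> wv; case: allw; exists v.
  have [|w Ew] := @effective_deg1 _ E eE.
    by rewrite -(lin_equiv_deg DE) raddfB /= dD unit_div_deg.
  exists w; apply/eqP; rewrite eqz_mod_dvd; apply/dvdzP.
  have /lin_equivP[f Df] := DE; have [k fk] := char0_principal f; exists k.
  by rewrite -fk -Df -/(chi _) !chiB Ew !chi_unit opprD addrA.
pose s := `|(chi D %% 24)%Z|%N.
(* No residue mod 24 can be written, for every [v], as the weight of [v] plus the weight of some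
   [w]. *)
have : all (fun s => ~~ all (fun v => has (fun w =>
    ((char0 0 v + char0 0 w) %% 24)%Z == s%:Z) (iota 0 6)) (iota 0 6)) (iota 0 24).
  by vm_compute.
have s0 : s%:Z = (chi D %% 24)%Z by rewrite gez0_abs // modz_ge0.
have s24 : s \in iota 0 24.
  by rewrite mem_iota add0n -ltz_nat s0 ltz_pmod.
move=> /allP /(_ _ s24) /negP []; apply/allP => v; rewrite mem_iota => /andP[_ v6].
have [w wv] := chi_equiv (Ordinal v6).
by apply/hasP; exists (val w); rewrite ?mem_iota ?ltn_ord // s0 wv.
Qed.

Lemma zeta_neq : zeta G2 <> zeta G0.
Proof.
move=> /(congr1 (fun z : int -> {poly int} => (z 2)`_1)); rewrite (zeta_coef1_eq0P G0 2).2.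
  case/zeta_coef1_eq0P/(_ (fun_mx 6 1 deg2_G2)) => [|v].
    by rewrite /div_deg !big_ord_recl big_ord0 !mxE.
  by apply; exact: winnable_G2.
exact: unwinnable_G0.
Qed.

Theorem theorem1p1 :
  exists G G' : graph,
    [/\ tutte G = tutte G',
        exists f : {additive Jac G -> Jac G'}, bijective f
      & zeta G <> zeta G'].
Proof.
by exists G2, G0; split; [exact: tutte_eq | exact: jac_G2_G0 | exact: zeta_neq].
Qed.
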